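(* Let $k,n\ge 1$ and let $\bm{\beta}/\bm{\gamma}=(\beta^{(1)}/\gamma^{(1)},\ldots,\beta^{(k)}/\gamma^{(k)})$ be a tuple of skew partitions (each $\beta^{(j)}$ and $\gamma^{(j)}$ having the same number $p_j\ge 1$ of parts, with $\gamma^{(j)}_m\le\beta^{(j)}_m$ for all $m$). Then the partition function of the lattice $L_{\bm{\beta}/\bm{\gamma}}$ equals the coinversion LLT polynomial: \[\mathcal{Z}_{\bm{\beta}/\bm{\gamma}}(x_1,\ldots,x_n;t)=\mathcal{L}_{\bm{\beta}/\bm{\gamma}}(x_1,\ldots,x_n;t).\]
   Context: Partitions have a fixed number of parts, zero parts allowed. Cells are pairs $(r,c)\in\mathbb{Z}\times\mathbb{Z}$ (row $r$, column $c$; French convention, rows numbered bottom to top). The skew shape $\beta^{(a)}/\gamma^{(a)}$ consists of the cells $(r,c)$ with $1\le r\le p_a$ and $\gamma^{(a)}_r<c\le\beta^{(a)}_r$. The content of $(r,c)$ is $c-r$. A semistandard tableau $T=(T^{(1)},\ldots,T^{(k)})$ of shape $\bm{\beta}/\bm{\gamma}$ with entries in $[n]$ fills each $\beta^{(a)}/\gamma^{(a)}$ with elements of $\{1,\ldots,n\}$, weakly increasing along rows (left to right) and strictly increasing up columns; $x^T=\prod_{\text{cells }u}x_{T(u)}$. A triple is $(u,v,w)$ where for some $a<b$: $v$ is a cell of $\beta^{(a)}/\gamma^{(a)}$, and $u=(r,c-1)$, $w=(r,c)$ for some $1\le r\le p_b$ with $w$ of the same content as $v$, $\gamma^{(b)}_r\le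 c-1$ and $c\le\beta^{(b)}_r+1$. For a tableau $T$, let $b$ be the entry of $v$ in $T^{(a)}$, $a'$ the entry of $u$ in $T^{(b)}$ if $u\in\beta^{(b)}/\gamma^{(b)}$ and $a'=0$ otherwise, and $c'$ the entry of $w$ in $T^{(b)}$ if $w\in\beta^{(b)}/\gamma^{(b)}$ and $c'=\infty$ otherwise; the triple is a coinversion triple of $T$ if $a'\le b\le c'$. $\mathrm{coinv}(T)$ is the number of coinversion triples, and $\mathcal{L}_{\bm{\beta}/\bm{\gamma}}(x_1,\ldots,x_n;t)=\sum_T t^{\mathrm{coinv}(T)}x^T$, summed over semistandard tableaux of shape $\bm{\beta}/\bm{\gamma}$ with entries in $[n]$. Lattice model: for $\bm{I}\in\{0,1\}^k$ write $|\bm{I}|=\sum_m I_m$ and $\bm{I}_{[i,j]}=\sum_{m=i}^j I_m$ (empty sum $0$). A face with bottom, left, top, right edge labels $\bm{I},\bm{J},\bm{K},\bm{L}\in\{0,1\}^k$ and spectral parameter $x$ has weight $L_x(\bm{I},\bm{J};\bm{K},\bm{L})=x^{|\bm{L}|}\prod_{m:L_m=1}t^{\bm{I}_{[m+1,k]}+\bm{J}_{[m+1,k]}}$ if $\bm{I}+\bm{J}=\bm{K}+\bm{L}$ and there is no $i$ with $I_i=J_i=1$, and $0$ otherwise. For a tuple of partitions $\bm{\mu}=(\mu^{(1)},\ldots,\mu^{(k)})$, $\mu^{(j)}$ with $p_j$ parts, and $i\in\mathbb{Z}$, let $\bm{\mu}(i)\in\{0,1\}^k$ have $j$-th component $1$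 iff $i=\mu^{(j)}_m-m+1$ for some $1\le m\le p_j$. Let $r=\min\{i:\bm{\gamma}(i)\ne\mathbf 0\}$ and $s=\max\{i:\bm{\beta}(i)\ne\mathbf 0\}$. The lattice $L_{\bm{\beta}/\bm{\gamma}}$ has rows $1,\ldots,n$ (bottom to top) and columns $r,\ldots,s$; the face in row $e$ has weight $L_{x_e}$; the bottom boundary edge of column $p$ is labeled $\bm{\gamma}(p)$, the top boundary edge of column $p$ is labeled $\bm{\beta}(p)$, and all left and right boundary edges are labeled $\mathbf 0$. $\mathcal{Z}_{\bm{\beta}/\bm{\gamma}}(x_1,\ldots,x_n;t)$ is the sum over all labelings of the internal edges by elements of $\{0,1\}^k$ of the product of the face weights. *)

(* Defs.v *)
From HB Require Import structures.
From mathcomp Require Import all_boot all_order all_algebra.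
From mathcomp Require Import mpoly.

Set Implicit Arguments.
Unset Strict Implicit.
Unset Printing Implicit Defensive.

Import Order.TTheory GRing.Theory Num.Theory.

Local Open Scope ring_scope.

(* A partition with p parts (zero parts allowed) is a weakly decreasing       *)
(* sequence of length p; [part mu m] is its m-th part, 1 <= m <= p.           *)
Definition is_partition (p : nat) (mu : seq nat) : Prop :=
  size mu = p /\ sorted geq mu.

Definition part (mu : seq nat) (m : nat) : nat := nth 0%N mu m.-1.

(* A cell (r, c) has row r and column c, both numbered from 1.                *)
Definition cell := (nat * nat)%type.

Definition content (u : cell) : int := u.2%:Z - u.1%:Z.

Definition skew_cells (beta gamma : seq nat) : seq cell :=
  [seq (r, c) | r <- iota 1 (size beta),
                c <- iota (part gamma r).+1 (part beta r - part gamma r)].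

Lemma mem_skew_cells (beta gamma : seq nat) (r c : nat) :
  ((r, c) \in skew_cells beta gamma) =
  (1 <= r <= size beta)%N && (part gamma r < c <= part beta r)%N.
Proof.
apply/allpairsPdep/idP => [[r' [c' [rin cin [-> ->]]]]|/andP[rin cin]].
  move: rin cin; rewrite !mem_iota add1n ltnS => -> /= /andP[lo hi].
  rewrite lo -ltnS (leq_trans hi) // addSn ltnS.
  case: (leqP (part gamma r') (part beta r')) => [le|lt]; first by rewrite subnKC.
  by move: hi; rewrite (eqP (ltnW lt)) addn0 ltnNge lo.
exists r, c; split=> //; first by rewrite mem_iota add1n ltnS.
have /andP[lo hi] := cin.
by rewrite mem_iota lo addSn ltnS subnKC // ltnW // (leq_trans lo).
Qed.

(* A filling of beta/gamma by [n]; the ordinal i : 'I_n stands for the entry  *)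
(* i + 1.                                                                     *)
Definition filling (n : nat) (beta gamma : seq nat) : finType :=
  {ffun seq_sub (skew_cells beta gamma) -> 'I_n}.

Definition semistandard (n : nat) (beta gamma : seq nat)
    (T : filling n beta gamma) : bool :=
  [forall u, forall v,
     (((ssval u).1 == (ssval v).1) && ((ssval u).2 < (ssval v).2)%N
        ==> (T u <= T v)%N)
  && (((ssval u).2 == (ssval v).2) && ((ssval u).1 < (ssval v).1)%N
        ==> (T u < T v)%N)].

Definition tuple_filling (n k : nat) (beta gamma : 'I_k -> seq nat) : finType :=
  {dffun forall a : 'I_k, filling n (beta a) (gamma a)}.

(* Cells u outside of the shape carry the entry 0, and cells w outside of the *)
(* shape the entry infinity, so that a' <= b, resp. b <= c', then holds.      *)
Definition coinversion_condition (n : nat) (beta gamma : seq nat)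
    (T : filling n beta gamma) (u : cell) (b : 'I_n) (w : cell) : bool :=
  (if insub u is Some u' then (T u' <= b)%N else true) &&
  (if insub w is Some w' then (b <= T w')%N else true).

(* A triple is determined by a < b, by v in beta^(a)/gamma^(a), and by        *)
(* w = (r, c) with 1 <= r <= p_b and gamma^(b)_r <= c - 1,                    *)
(* c <= beta^(b)_r + 1; then u = (r, c - 1).                                  *)
Definition coinv (n k : nat) (beta gamma : 'I_k -> seq nat)
    (T : tuple_filling n beta gamma) : nat :=
  (\sum_(a < k) \sum_(b < k | (a < b)%N)
   \sum_(v : seq_sub (skew_cells (beta a) (gamma a)))
   \sum_(1 <= r < (size (beta b)).+1)
   \sum_((part (gamma b) r).+1 <= c < (part (beta b) r).+2)
     ((content (r, c) == content (ssval v)) &&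
      coinversion_condition (T b) (r, c.-1) (T a v) (r, c)))%N.

Definition coinv_LLT (R : comNzRingType) (n k : nat)
    (beta gamma : 'I_k -> seq nat) (x : 'I_n -> R) (t : R) : R :=
  \sum_(T : tuple_filling n beta gamma | [forall a, semistandard (T a)])
    t ^+ coinv T *
    \prod_(a < k) \prod_(u : seq_sub (skew_cells (beta a) (gamma a))) x (T a u).

Definition label (k : nat) : finType := {ffun 'I_k -> bool}.

Definition label0 (k : nat) : label k := [ffun=> false].

Definition lsize (k : nat) (I : label k) : nat := (\sum_(m < k) I m)%N.

(* I_[m+1,k] *)
Definition lsum_above (k : nat) (I : label k) (m : 'I_k) : nat :=
  (\sum_(l < k | (m < l)%N) I l)%N.

(* bottom I, left J, top K, right L *)
Definition face_weight (R : comNzRingType) (k : nat) (t x : R)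
    (I J K L : label k) : R :=
  if [forall i, (I i + J i)%N == (K i + L i)%N] && ~~ [exists i, I i && J i]
  then x ^+ lsize L *
       \prod_(m < k | L m) t ^+ (lsum_above I m + lsum_above J m)%N
  else 0.

Definition position (mu : seq nat) (m : nat) : int :=
  (part mu m)%:Z - m%:Z + 1.

(* bold-mu(i) *)
Definition label_at (k : nat) (mu : 'I_k -> seq nat) (i : int) : label k :=
  [ffun j => has (fun m => i == position (mu j) m) (iota 1 (size (mu j)))].

Definition positions (k : nat) (mu : 'I_k -> seq nat) : seq int :=
  [seq position (mu j) m | j <- enum 'I_k, m <- iota 1 (size (mu j))].

(* The least and the greatest i with bold-mu(i) != 0: see first_columnP and   *)
(* last_columnP; the head default is irrelevant for nonempty positions.       *)
Definition first_column (k : nat) (mu : 'I_k -> seq nat) : int :=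
  foldr Num.min (head 0 (positions mu)) (positions mu).

Definition last_column (k : nat) (mu : 'I_k -> seq nat) : int :=
  foldr Num.max (head 0 (positions mu)) (positions mu).

Lemma label_at_neq0 (k : nat) (mu : 'I_k -> seq nat) (i : int) :
  (label_at mu i != label0 k) = (i \in positions mu).
Proof.
apply/idP/allpairsPdep => [neq0|[j [m [_ min ->]]]].
  have [/existsP[j]|nex] := boolP [exists j, label_at mu i j].
    by rewrite ffunE => /hasP[m min /eqP ->]; exists j, m; rewrite mem_enum.
  case/eqP: neq0; apply/ffunP => j; rewrite [RHS]ffunE; apply/negbTE.
  by apply: contra nex => labj; apply/existsP; exists j.
apply/eqP => /ffunP/(_ j); rewrite !ffunE => /negbT/negP; apply.
by apply/hasP; exists m.
Qed.

Lemma first_columnP (k : nat) (mu : 'I_k -> seq nat) (i : int) :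
  label_at mu i != label0 k ->
  label_at mu (first_column mu) != label0 k /\ first_column mu <= i.
Proof.
rewrite !label_at_neq0 /first_column.
case: (positions mu) => // a s; rewrite [head _ _]/= => iin; split; last first.
  elim: (a :: s) iin => // b s' IH; rewrite inE /= => /orP[/eqP ->|/IH le].
    by rewrite ge_min lexx.
  by rewrite ge_min le orbT.
have mem s' : foldr Num.min a s' \in a :: s'.
  elim: s' => [|b s' IH] /=; first by rewrite inE.
  rewrite minEle; case: ifP => _; first by rewrite !inE eqxx orbT.
  by move: IH; rewrite !inE => /orP[->|->] //; rewrite !orbT.
by have := mem (a :: s); rewrite !inE orbA orbb.
Qed.

Lemma last_columnP (k : nat) (mu : 'I_k -> seq nat) (i : int) :
  label_at mu i != label0 k ->
  label_at mu (last_column mu) != label0 k /\ i <= last_column mu.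
Proof.
rewrite !label_at_neq0 /last_column.
case: (positions mu) => // a s; rewrite [head _ _]/= => iin; split; last first.
  elim: (a :: s) iin => // b s' IH; rewrite inE /= => /orP[/eqP ->|/IH le].
    by rewrite le_max lexx.
  by rewrite le_max le orbT.
have mem s' : foldr Num.max a s' \in a :: s'.
  elim: s' => [|b s' IH] /=; first by rewrite inE.
  rewrite maxEle; case: ifP => _; last by rewrite !inE eqxx orbT.
  by move: IH; rewrite !inE => /orP[->|->] //; rewrite !orbT.
by have := mem (a :: s); rewrite !inE orbA orbb.
Qed.

Definition n_columns (k : nat) (beta gamma : 'I_k -> seq nat) : nat :=
  absz (last_column beta - first_column gamma + 1).

Definition column (k : nat) (gamma : 'I_k -> seq nat) (q : nat) : int :=
  first_column gamma + q%:Z.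

(* An edge labeling is a pair (V, H). The face in row e and column q (both    *)
(* numbered from 0) has bottom edge V e q, top edge V (e+1) q, left edge      *)
(* H e q and right edge H e (q+1). Labelings of the internal edges are        *)
(* labelings of all the edges with the prescribed boundary labels.            *)
Definition boundary_labels (n k : nat) (beta gamma : 'I_k -> seq nat)
    (V : 'M[label k]_(n.+1, n_columns beta gamma))
    (H : 'M[label k]_(n, (n_columns beta gamma).+1)) : bool :=
  [forall q, (V ord0 q == label_at gamma (column gamma q)) &&
             (V ord_max q == label_at beta (column gamma q))] &&
  [forall e, (H e ord0 == label0 k) && (H e ord_max == label0 k)].

Definition lattice_Z (R : comNzRingType) (n k : nat)
    (beta gamma : 'I_k -> seq nat) (x : 'I_n -> R) (t : R) : R :=
  \sum_(V : 'M[label k]_(n.+1, n_columns beta gamma))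
  \sum_(H : 'M[label k]_(n, (n_columns beta gamma).+1) | boundary_labels V H)
    \prod_(e < n) \prod_(q < n_columns beta gamma)
      face_weight t (x e)
        (V (widen_ord (leqnSn n) e) q) (H e (widen_ord (leqnSn _) q))
        (V (lift ord0 e) q) (H e (lift ord0 q)).

(* The polynomials in Z[t][x_1, ..., x_n].                                    *)
Definition coinv_LLT_poly (n k : nat) (beta gamma : 'I_k -> seq nat) :
    {mpoly {poly int}[n]} :=
  coinv_LLT beta gamma (fun i : 'I_n => 'X_i) ('X%:MP).

Definition lattice_Z_poly (n k : nat) (beta gamma : 'I_k -> seq nat) :
    {mpoly {poly int}[n]} :=
  lattice_Z beta gamma (fun i : 'I_n => 'X_i) ('X%:MP).

(* Main.v *)
(* Fix a colour j. A labeling with nonzero weight is determined in colour j by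
   its height function: N e q is the number of vertical edges of column >= q
   crossed by paths of colour j between rows e - 1 and e. Conservation says that
   the horizontal edge (e, q) carries N (e+1) q - N e q, the vertical edge (e, q)
   carries N e q - N e (q+1), and the exclusion rule becomes
   N (e+1) q <= N e (q+1) + 1. A semistandard tableau T has the height function
   counting the rows r of {T < e} whose end has position >= q, and
     T (r, c) < e  <->  r <= N e (c - r + 1),
   where the second argument of N is measured from the first column. This
   equivalence determines each of T and N from the other: monotonicity of N gives
   the row condition, the exclusion rule gives the column condition. It also shows
   that colour a leaves the face (e, q) on the right exactly when the diagonal of
   content q contains a (unique) cell v of T^(a) with entry e, and that colour b
   enters that face exactly when v is part of a (unique) coinversion triple in
   T^(b), so that the weights agree face by face. *)

Require Import Defs.
From mathcomp Require Import all_boot all_order all_algebra.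
From mathcomp Require Import mpoly.
From mathcomp Require Import zify.

Set Implicit Arguments.
Unset Strict Implicit.
Unset Printing Implicit Defensive.

Import Order.TTheory GRing.Theory Num.Theory.

(** * Counting with sums of booleans *)

Lemma sum_bool_leq (m n : nat) (P : nat -> bool) :
  (\sum_(m <= i < n) P i <= n - m)%N.
Proof.
rewrite -[leqRHS]muln1 -sum_nat_const_nat.
by apply: leq_sum => i _; case: (P i).
Qed.

Lemma sum_half_open (p a b : nat) :
  (\sum_(1 <= r < p.+1) (a < r <= b) = minn b p - a)%N.
Proof.
elim: p => [|p IHp]; first by rewrite big_geq //; lia.
by rewrite big_nat_recr //= IHp; lia.
Qed.

(** A downward closed set of indices is an initial segment, so its size alone decides membership.
    This serves three times: for partitions, for tableaux, and for the filling read off from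
    heights. *)
Lemma leq_sum_prefix (p : nat) (P : nat -> bool) :
    (forall r, (1 <= r < p)%N -> P r.+1 -> P r) ->
  forall r, (1 <= r <= p)%N -> (r <= \sum_(1 <= i < p.+1) P i) = P r.
Proof.
elim: p => [|p IHp] antiP r rp; first lia.
have antiP' r' : (1 <= r' < p)%N -> P r'.+1 -> P r' by move=> ?; apply: antiP; lia.
rewrite big_nat_recr //=.
have le_p := sum_bool_leq 1 p.+1 P; rewrite subn1 /= in le_p.
(* If the top index satisfies [P], closure propagates it to every index and the sum is full;
   otherwise the top term vanishes and induction applies below it. *)
have [Pp|nPp] := boolP (P p.+1).
  have allP d : (d <= p)%N -> P (p.+1 - d)%N.
    elim: d => [|d IHd] dp; first by rewrite subn0.
    by apply: antiP; [lia | rewrite (_ : _.+1 = p.+1 - d)%N; [apply: IHd; lia | lia]].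
  have Pr : P r by rewrite (_ : r = p.+1 - (p.+1 - r))%N; [apply: allP; lia | lia].
  rewrite Pr (eq_big_nat _ _ (F2 := fun _ => 1%N)) => [|i ip].
    by rewrite sum_nat_const_nat; lia.
  have := allP (p.+1 - i)%N; rewrite (_ : p.+1 - (p.+1 - i) = i)%N; last lia.
  by move=> ->; lia.
rewrite addn0; have [r_le|r_gt] := leqP r p; first by apply: IHp => //; lia.
rewrite (_ : r = p.+1) ?(negbTE nPp); lia.
Qed.

Local Open Scope ring_scope.

(* f is the first column of the lattice and nc its number of columns. *)
Record skew_window (p nc : nat) (f : int) (beta gamma : seq nat) : Prop := SkewWindow {
  sw_size_beta : size beta = p;
  sw_size_gamma : size gamma = p;
  sw_beta_anti : forall r, (1 <= r < p)%N -> (part beta r.+1 <= part beta r)%N;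
  sw_gamma_anti : forall r, (1 <= r < p)%N -> (part gamma r.+1 <= part gamma r)%N;
  sw_gamma_le_beta : forall r, (1 <= r <= p)%N -> (part gamma r <= part beta r)%N;
  sw_first_le : forall r, (1 <= r <= p)%N -> f <= position gamma r;
  sw_lt_last : forall r, (1 <= r <= p)%N -> position beta r < f + nc%:Z }.

(** * One colour: cells, diagonals and heights *)

Section Heights.

Variables (p n nc : nat) (f : int) (beta gamma : seq nat).
Hypothesis window : skew_window p nc f beta gamma.

Let size_beta := sw_size_beta window.
Let size_gamma := sw_size_gamma window.
Let beta_anti := sw_beta_anti window.
Let gamma_anti := sw_gamma_anti window.
Let gamma_le_beta := sw_gamma_le_beta window.
Let first_le := sw_first_le window.
Let lt_last := sw_lt_last window.

Local Notation cells := (seq_sub (skew_cells beta gamma)).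
Implicit Types (T : filling n beta gamma) (u v : cells) (N : nat -> nat -> nat).

Definition row u : nat := (ssval u).1.
Definition col u : nat := (ssval u).2.

Lemma cell_inj u v : row u = row v -> col u = col v -> u = v.
Proof.
rewrite /row /col => eqr eqc; apply: val_inj => /=.
by case: (ssval u) (ssval v) eqr eqc => r c [r' c'] /= -> ->.
Qed.

Lemma cellP u : (1 <= row u <= p)%N /\
  (part gamma (row u) < col u <= part beta (row u))%N.
Proof.
have := ssvalP u; rewrite /row /col; case: (ssval u) => r c /=.
by rewrite mem_skew_cells size_beta => /andP[].
Qed.

Lemma cell_ex (r c : nat) : (1 <= r <= p)%N -> (part gamma r < c <= part beta r)%N ->
  exists2 u : cells, row u = r & col u = c.
Proof.
move=> rp cr; have rcin : (r, c) \in skew_cells beta gamma.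
  by rewrite mem_skew_cells size_beta rp cr.
by exists (SeqSub rcin).
Qed.

(** Content counted from the first column. The argument of [absz] is nonnegative because a cell lies
    to the right of [gamma], whose positions are at least [f]. *)
Definition diagonal u : nat := absz ((col u)%:Z - (row u)%:Z - f)%R.

Lemma diagonalE u : f + (diagonal u)%:Z = (col u)%:Z - (row u)%:Z.
Proof.
have [rp /andP[cr _]] := cellP u; have := first_le rp.
by rewrite /diagonal /position; lia.
Qed.

Lemma diagonal_lt u : ((diagonal u).+1 < nc)%N.
Proof.
have [rp /andP[_ cr]] := cellP u; have := lt_last rp; have := diagonalE u.
by rewrite /position; lia.
Qed.

Definition height (mu : seq nat) (q : nat) : nat :=
  (\sum_(1 <= r < p.+1) (f + q%:Z <= position mu r)%R)%N.

(** Weakly decreasing parts give strictly decreasing positions, so the rows reaching column [q] form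
    an initial segment. *)
Lemma leq_height (mu : seq nat) :
    (forall r, (1 <= r < p)%N -> (part mu r.+1 <= part mu r)%N) ->
  forall r q, (1 <= r <= p)%N -> (r <= height mu q)%N = (f + q%:Z <= position mu r).
Proof.
move=> mu_anti r q rp.
rewrite /height (leq_sum_prefix (P := fun r => f + q%:Z <= position mu r)) //.
by move=> r' /mu_anti; rewrite /position; lia.
Qed.

Lemma height_le (mu : seq nat) q : (height mu q <= p)%N.
Proof. by have := sum_bool_leq 1 p.+1 (fun r => f + q%:Z <= position mu r); rewrite subn1. Qed.

(** Positions are strictly decreasing, so at most one row ends at each of them. *)
Lemma height_step (mu : seq nat) q :
    (forall r, (1 <= r < p)%N -> (part mu r.+1 <= part mu r)%N) ->
  size mu = p ->
  height mu q = (height mu q.+1 + has (fun m => (f + q%:Z == position mu m)%R) (iota 1 (size mu)))%N.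
Proof.
move=> mu_anti size_mu; have le := leq_height mu_anti; rewrite size_mu.
have le1 : (height mu q.+1 <= height mu q)%N by apply: leq_sum => r _; lia.
have le2 : (height mu q <= (height mu q.+1).+1)%N.
  case E : (height mu q) => [|[|s]] //.
  have sp := height_le mu q; have := le s.+2 q; have := le s.+1 q.+1.
  have := mu_anti s.+1; rewrite /position E; lia.
case: hasP => [[r]|nhas].
  rewrite mem_iota => rp /eqP qE.
  have := le r q; have := le r q.+1; lia.
have [eq|lt] := leqP (height mu q) (height mu q.+1); first lia.
case: nhas; exists (height mu q); rewrite ?mem_iota; first by have := height_le mu q; lia.
have := le (height mu q) q; have := le (height mu q) q.+1.
have := height_le mu q; lia.
Qed.

Lemma height_gamma0 : height gamma 0 = p.
Proof.
rewrite /height (eq_big_nat _ _ (F2 := fun _ => 1%N)) => [|r rp].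
  by rewrite sum_nat_const_nat; lia.
by have := first_le (r := r); lia.
Qed.

Lemma height_beta_last q : (nc <= q)%N -> height beta q = 0%N.
Proof.
move=> ncq; rewrite /height big_nat big1 // => r rp.
by have := lt_last (r := r); lia.
Qed.

(* Columns are numbered from 0, i.e. q stands for the column f + q. *)
Record height_function N : Prop := HeightFunction {
  hf_col : forall e q, (e <= n)%N -> (N e q.+1 <= N e q)%N;
  hf_row : forall e q, (e < n)%N -> (N e q <= N e.+1 q)%N;
  hf_step : forall e q, (e < n)%N -> (N e.+1 q <= (N e q.+1).+1)%N;
  hf_bot : forall q, N 0%N q = height gamma q;
  hf_top : forall q, N n q = height beta q }.

Definition encodes T N : Prop :=
  forall u e, (e <= n)%N -> (T u < e)%N = (row u <= N e (diagonal u).+1)%N.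

Section HeightFunctionTheory.

Variable N : nat -> nat -> nat.
Hypothesis hfN : height_function N.

Lemma hf_row_le e e' q : (e <= e' <= n)%N -> (N e q <= N e' q)%N.
Proof.
elim: e' => [|e' IH] ee'; first by have -> : e = 0%N by lia.
have [lt|] := ltnP e e'.+1; last by move=> ge; have -> : e = e'.+1 by lia.
by apply: leq_trans (IH _) (hf_row hfN _ _); lia.
Qed.

(** The bound combines [hf_row] with [hf_step] across one level: the level above [e] when [e < n],
    the level below when [e = n], which exists because [0 < n]. *)
Lemma hf_col_step e q : (0 < n)%N -> (e <= n)%N -> (N e q <= (N e q.+1).+1)%N.
Proof.
move=> n_gt0 en; have [lt|ge] := ltnP e n.
  exact: leq_trans (hf_row hfN _ lt) (hf_step hfN _ lt).
case: e en ge => [|e] en ge; first lia.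
by have := hf_step hfN q en; have := hf_row hfN q.+1 en; lia.
Qed.

(** Heights increase with the level, from those of [gamma] to those of [beta]. This bound and
    [hf_beta] control [N] where the shape has no cell. *)
Lemma hf_gamma e q r : (e <= n)%N -> (1 <= r <= p)%N ->
  f + q%:Z <= position gamma r -> (r <= N e q)%N.
Proof.
move=> en rp; rewrite -(leq_height gamma_anti) // -(hf_bot hfN) => /leq_trans -> //.
exact: hf_row_le.
Qed.

Lemma hf_beta e q r : (e <= n)%N -> (1 <= r <= p)%N ->
  (r <= N e q)%N -> f + q%:Z <= position beta r.
Proof.
move=> en rp rN; rewrite -(leq_height beta_anti) // -(hf_top hfN) (leq_trans rN) //.
by apply: hf_row_le; rewrite en leqnn.
Qed.

Lemma hf_le e q : (e <= n)%N -> (N e q <= p)%N.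
Proof.
move=> en; apply: leq_trans (height_le beta q); rewrite -(hf_top hfN).
by apply: hf_row_le; rewrite en leqnn.
Qed.

(** Both differences of heights are 0 or 1, so the indicators telescope. The left side counts the
    paths entering the face; the right side reappears in [sum_coinversion_triples]. *)
Lemma hf_face e q : (e < n)%N ->
  ((N e q.+1 < N e q) + (N e q < N e.+1 q) = N e.+1 q - N e q.+1)%N.
Proof.
move=> en; have := hf_col hfN q (ltnW en); have := hf_row hfN q en.
by have := hf_step hfN q en; lia.
Qed.

End HeightFunctionTheory.

Lemma encodes_inj T T' N : encodes T N -> encodes T' N -> T = T'.
Proof.
move=> TN T'N; apply/ffunP => u; apply/val_inj => /=.
apply/eqP; rewrite eqn_leq -ltnS -[X in _ && X]ltnS.
by rewrite TN ?ltn_ord // -T'N ?ltn_ord // ltnSn T'N ?ltn_ord // -TN ?ltn_ord // ltnSn.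
Qed.

(** Row [N e q] either lies within [gamma] at this position, where every height function includes
    it, or has a cell of content [f + q - 1], whose entry in [T] decides. *)
Lemma encodes_uniq T N N' : height_function N -> height_function N' ->
  encodes T N -> encodes T N' -> forall e q, (e <= n)%N -> N e q = N' e q.
Proof.
have main M M' e q : height_function M -> height_function M' ->
    encodes T M -> encodes T M' -> (e <= n)%N -> (M e q <= M' e q)%N.
  move=> hM hM' TM TM' en; case E: (M e q) => [|r] //; rewrite -E.
  have rp := hf_le hM q en.
  have r1p : (1 <= M e q <= p)%N by lia.
  have := hf_beta hM en r1p (leqnn _).
  have [/(hf_gamma hM' en r1p)//|gt leb] := lerP (f + q%:Z) (position gamma (M e q)).
  pose c := absz (f + q%:Z - 1 + (M e q)%:Z)%R.
  have [|u ur uc] := @cell_ex (M e q) c r1p; first by move: gt leb; rewrite /position /c; lia.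
  have qE : q = (diagonal u).+1.
    by have := diagonalE u; move: gt; rewrite ur uc /position /c; lia.
  have := TM u e en; rewrite TM' // ur -qE; lia.
move=> hN hN' TN TN' e q en; apply/eqP; rewrite eqn_leq.
by apply/andP; split; apply: main.
Qed.

Lemma encodes_semistandard T N : height_function N -> encodes T N -> semistandard T.
Proof.
move=> hN TN; apply/forallP => u; apply/forallP => v; apply/andP; split.
all: apply/implyP => /andP[/eqP eq lt]; have := diagonalE u; have := diagonalE v => dv du.
  change (row u = row v) in eq; change (is_true (col u < col v)%N) in lt.
  have Tv : (row v <= N (T v).+1 (diagonal v).+1)%N by rewrite -TN.
  rewrite -ltnS TN ?ltn_ord // eq (leq_trans Tv) //.
  have : (diagonal u <= diagonal v)%N by lia.
  elim: (diagonal v) => [|d IH] ud; first by have -> : diagonal u = 0%N by lia.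
  have [le|] := leqP (diagonal u) d; last by move=> gt; have -> : diagonal u = d.+1 by lia.
  by apply: leq_trans (IH le); apply: (hf_col hN).
change (col u = col v) in eq; change (is_true (row u < row v)%N) in lt.
have n_gt0 : (0 < n)%N by apply: leq_ltn_trans (ltn_ord (T v)).
have Tv : (row v <= N (T v).+1 (diagonal v).+1)%N by rewrite -TN.
rewrite TN; last exact: ltnW.
(* Changing level uses the exclusion rule once; each further column costs at most one by
   [hf_col_step]. For [d = row v - row u - 1] the diagonal of [u] is reached, and the bound becomes
   [row u <= N (T v) (diagonal u).+1]. *)
have step d : (row v <= (N (T v) ((diagonal v).+2 + d)%N).+1 + d)%N.
  elim: d => [|d IH]; first by rewrite !addn0 (leq_trans Tv) //; apply: (hf_step hN).
  have := hf_col_step hN ((diagonal v).+2 + d) n_gt0 (ltnW (ltn_ord (T v))).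
  by rewrite -addnS; lia.
have := step (row v - row u).-1.
have -> : ((diagonal v).+2 + (row v - row u).-1 = (diagonal u).+1)%N by lia.
lia.
Qed.

(* The row r of the shape {T < e}, extended to the left by gamma and beyond
   column 0, ends at a position >= f + q. *)
Definition below T (e r q : nat) : bool :=
  (f + q%:Z <= position gamma r) ||
  [exists u, [&& row u == r, (diagonal u).+1 == q & (T u < e)%N]].

Definition tableau_height T (e q : nat) : nat := (\sum_(1 <= r < p.+1) below T e r q)%N.

Lemma belowP T e r q :
  reflect (f + q%:Z <= position gamma r \/
           exists u, [/\ row u = r, (diagonal u).+1 = q & (T u < e)%N])
          (below T e r q).
Proof.
apply: (iffP orP) => -[|]; try by left.
  by case/existsP => u /and3P[/eqP ? /eqP ? ?]; right; exists u.
by case=> u [? ? ?]; right; apply/existsP; exists u; apply/and3P; split=> //; apply/eqP.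
Qed.

(** * The height function of a semistandard tableau *)

Section Semistandard.

Variable T : filling n beta gamma.
Hypothesis ssT : semistandard T.

Lemma semistandard_row u v : row u = row v ->
  (col u < col v)%N -> (T u <= T v)%N.
Proof.
move=> eq lt; have /forallP/(_ u)/forallP/(_ v)/andP[/implyP H _] := ssT.
by apply: H; apply/andP; split; first exact/eqP.
Qed.

Lemma semistandard_col u v : col u = col v ->
  (row u < row v)%N -> (T u < T v)%N.
Proof.
move=> eq lt; have /forallP/(_ u)/forallP/(_ v)/andP[_ /implyP H] := ssT.
by apply: H; apply/andP; split; first exact/eqP.
Qed.

Lemma below_row e r q : (1 <= r <= p)%N -> below T e r q.+1 -> below T e r q.
Proof.
move=> rp /belowP[le|[u [ur [uq] ue]]]; apply/belowP; first by left; lia.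
have [le|gt] := lerP (f + q%:Z) (position gamma r); [by left|right].
have [_ cu] := cellP u; have dq := diagonalE u.
move: gt cu dq; rewrite /position ur uq => gt cu dq.
have [|v vr vc] := @cell_ex r (col u).-1 rp; first lia.
exists v; split=> //; first by have := diagonalE v; rewrite vr vc; lia.
by apply: leq_ltn_trans ue; apply: semistandard_row; rewrite ?vr ?vc ?ur //; lia.
Qed.

Lemma below_entry e r q : below T e r q -> below T e.+1 r q.
Proof.
move=> /belowP[le|[u [ur uc ue]]]; apply/belowP; [by left | right].
by exists u; split=> //; lia.
Qed.

(** The cell directly below has content larger by one and a strictly smaller entry, which lowers the
    level by one. If that cell is missing, [gamma] already reaches the position. *)
Lemma below_col e r q : (1 <= r < p)%N -> below T e.+1 r.+1 q -> below T e r q.+1.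
Proof.
move=> rp; have ga := gamma_anti rp; have ba := beta_anti rp.
move=> /belowP[le|[u [ur uq ue]]]; apply/belowP.
  by left; move: le; rewrite /position; lia.
have [le|gt] := lerP (f + q.+1%:Z) (position gamma r); [by left|right].
have [_ cu] := cellP u; have dq := diagonalE u.
move: gt cu dq; rewrite /position ur => gt cu dq.
have [||v vr vc] := @cell_ex r (col u); [lia|lia|].
exists v; split=> //; first by have := diagonalE v; rewrite vr vc; lia.
by apply: leq_trans (_ : T u <= e)%N => //; apply: semistandard_col; rewrite ?vr ?vc ?ur.
Qed.

Lemma leq_tableau_height e q r : (1 <= r <= p)%N ->
  (r <= tableau_height T e q)%N = below T e r q.
Proof.
rewrite /tableau_height => rp; rewrite (leq_sum_prefix (P := fun r => below T e r q)) //.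
move=> r' r'p lo; apply: below_row; first lia.
by apply: below_col => //; apply: below_entry.
Qed.

Lemma below_bot r q : below T 0 r q = (f + q%:Z <= position gamma r).
Proof. by apply/belowP/idP => [[//|[u []]]|]; [|left]. Qed.

Lemma below_top r q : (1 <= r <= p)%N -> below T n r q = (f + q%:Z <= position beta r).
Proof.
move=> rp; have gb := gamma_le_beta rp; apply/belowP/idP => [[le|[u [ur uq _]]]|le].
- by move: le; rewrite /position; lia.
- by have [_] := cellP u; have := diagonalE u; rewrite /position ur; lia.
have [le'|gt] := lerP (f + q%:Z) (position gamma r); [by left|right].
have [|u ur uc] := @cell_ex r (absz (f + q%:Z - 1 + r%:Z)%R) rp.
  by move: le gt; rewrite /position; lia.
exists u; split=> //; move: gt (first_le rp) (diagonalE u).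
by rewrite /position ur uc; lia.
Qed.

Lemma tableau_height_function : height_function (tableau_height T).
Proof.
have hle e q : (tableau_height T e q <= p)%N.
  by have := sum_bool_leq 1 p.+1 (fun r => below T e r q); rewrite subn1.
split=> [e q en|e q en|e q en|q|q].
- rewrite /tableau_height !big_nat; apply: leq_sum => r rp.
  by have := @below_row e r q; case: (below T e r q.+1); case: (below T e r q) => // ->.
- apply: leq_sum => r _.
  by have := @below_entry e r q; case: (below T e r q); case: (below T e.+1 r q) => // ->.
(* Only heights of at least 2 need an argument: row [s.+2] is counted at level [e.+1], so
   [below_col] makes row [s.+1] count at level [e], one column further. *)
- case E: (tableau_height T e.+1 q) => [|[|s]] //; rewrite ltnS.
  have sp := hle e.+1 q.
  rewrite leq_tableau_height; last lia.
  apply: below_col; first lia.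
  by rewrite -leq_tableau_height ?E //; lia.
- by apply: eq_bigr => r _; rewrite below_bot.
- by rewrite /tableau_height /height; apply: eq_big_nat => r rp; rewrite below_top.
Qed.

Lemma tableau_height_encodes : encodes T (tableau_height T).
Proof.
move=> u e en; have [rp cu] := cellP u; rewrite leq_tableau_height //.
apply/idP/belowP => [ue|[le|[v [vr [vq] ve]]]].
- by right; exists u.
- by have := diagonalE u; move: le cu; rewrite /position; lia.
suff -> : u = v by [].
by have := diagonalE u; have := diagonalE v; rewrite vq vr => *; apply: cell_inj; lia.
Qed.

End Semistandard.

(** * Counting cells and coinversion triples by heights *)

Section Weights.

Variables (T : filling n beta gamma) (N : nat -> nat -> nat).
Hypotheses (hfN : height_function N) (TN : encodes T N).

Lemma encodes_eq u e : (e < n)%N ->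
  (T u == e :> nat) = (N e (diagonal u).+1 < row u <= N e.+1 (diagonal u).+1)%N.
Proof. by move=> en; have := TN u en; have := TN u (ltnW en); lia. Qed.

(** The rows allowed by [encodes_eq] form an interval with at most one element, [N e.+1 q.+1]. When
    it is nonempty, [hf_gamma] and [hf_beta] place the cell of content [f + q] in that row inside
    the shape. *)
Lemma sum_cells_diagonal e (q : nat) : (e < n)%N ->
  (\sum_u ((T u == e :> nat) && (diagonal u == q)) = (N e q.+1 < N e.+1 q.+1)%N)%N.
Proof.
move=> en; have mono := hf_row hfN q.+1 en.
have := hf_step hfN q.+1 en; have := hf_col hfN q.+1 (ltnW en) => anti step.
have [eq|lt] := leqP (N e.+1 q.+1) (N e q.+1).
  rewrite big1 // => u _; rewrite encodes_eq //.
  by case: eqP => [->|_]; rewrite ?andbF //; lia.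
have rp : (1 <= N e.+1 q.+1 <= p)%N by have := hf_le hfN q.+1 en; lia.
have leb := hf_beta hfN en rp (leqnn _).
have gtg : ~~ (f + q.+1%:Z <= position gamma (N e.+1 q.+1)).
  by apply/negP => /(hf_gamma hfN (ltnW en) rp); rewrite leqNgt lt.
have [|u ur uc] := @cell_ex (N e.+1 q.+1) (absz (f + q%:Z + (N e.+1 q.+1)%:Z)%R) rp.
  by move: leb gtg; rewrite /position; lia.
have uq : diagonal u = q.
  by have := diagonalE u; move: gtg; rewrite ur uc /position; lia.
rewrite (bigD1 u) //= big1 ?addn0 => [|v vu]; rewrite encodes_eq //.
  by rewrite uq eqxx ur lt leqnn.
case: (diagonal v =P q) => [vq|]; rewrite ?andbF //.
rewrite vq andbT; case: (boolP (_ < _ <= _)%N) => // vr; case/eqP: vu.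
have vrE : row v = N e.+1 q.+1 by lia.
by apply: cell_inj; have := diagonalE v; have := diagonalE u; rewrite uq vq ?ur ?uc; lia.
Qed.

(** Each path leaving a face to the right is exchanged for the cell behind it. A constant [F] yields
    the power of [x]; an [F] counting entering paths of larger colours yields the power of [t]. *)
Lemma sum_right_labels (e : 'I_n) (F : nat -> nat) :
  (\sum_(q < nc) (N e q.+1 < N e.+1 q.+1) * F q = \sum_(u | T u == e) F (diagonal u))%N.
Proof.
under [LHS]eq_bigr => q _ do rewrite -(sum_cells_diagonal q (ltn_ord e)) big_distrl /=.
rewrite exchange_big [RHS]big_mkcond /=; apply: eq_bigr => u _.
rewrite (bigD1 (Ordinal (ltnW (diagonal_lt u)))) //= eqxx andbT big1 ?addn0 => [|q qu].
  by rewrite -[(T u == e)]/(T u == e :> nat); case: eqP; rewrite ?mul1n ?mul0n.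
by rewrite [diagonal u == q]eq_sym (_ : (q == diagonal u :> nat) = false) ?andbF //; apply/negbTE.
Qed.

(** The two inequalities are the encoding equivalence at [w] and at [u]. Here [w] can leave the
    shape only past the end of [beta], and [u] only into [gamma]; [hf_beta] and [hf_gamma] then
    agree with the entries infinity and 0. *)
Lemma coinversion_conditionE q r c (b : 'I_n) : (1 <= r <= p)%N ->
    (part gamma r < c < (part beta r).+2)%N -> c%:Z - r%:Z = f + q%:Z ->
  coinversion_condition T (r, c.-1) b (r, c) = (N b q.+1 < r <= N b.+1 q)%N.
Proof.
move=> rp cr cq; have en := ltn_ord b.
rewrite /coinversion_condition andbC; congr andb.
  case: insubP => [w _ wE|nw].
    have wr : row w = r by rewrite /row [ssval w]wE.
    have wc : col w = c by rewrite /col [ssval w]wE.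
    have dw : diagonal w = q by have := diagonalE w; rewrite wr wc; lia.
    have := TN w (ltnW en); rewrite wr dw; lia.
  symmetry; rewrite ltnNge; apply/negP => /(hf_beta hfN (ltnW en) rp).
  by move: nw; rewrite mem_skew_cells size_beta rp /position; lia.
case: insubP => [u _ uE|nu].
  have ur : row u = r by rewrite /row [ssval u]uE.
  have uc : col u = c.-1 by rewrite /col [ssval u]uE.
  have du : (diagonal u).+1 = q.
    by have [_] := cellP u; have := diagonalE u; rewrite ur uc; lia.
  have := TN u en; rewrite ur du; lia.
symmetry; apply: (hf_gamma hfN en rp).
by move: nu; rewrite mem_skew_cells size_beta rp /position; lia.
Qed.

Lemma sum_coinversion_triples (v : cell) (b : 'I_n) q : content v = f + q%:Z ->
  (\sum_(1 <= r < (size beta).+1)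
   \sum_((part gamma r).+1 <= c < (part beta r).+2)
     ((content (r, c) == content v) && coinversion_condition T (r, c.-1) b (r, c))
   = N b.+1 q - N b q.+1)%N.
Proof.
move=> vq; have en := ltn_ord b.
rewrite size_beta big_nat.
under eq_bigr => r rp.
  have -> : (\sum_((part gamma r).+1 <= c < (part beta r).+2)
     ((content (r, c) == content v) && coinversion_condition T (r, c.-1) b (r, c))
     = (N b q.+1 < r <= N b.+1 q)%N)%N.
    under eq_big_nat => c cr.
      have -> : ((content (r, c) == content v) && coinversion_condition T (r, c.-1) b (r, c))
          = (content (r, c) == content v) && (N b q.+1 < r <= N b.+1 q)%N.
        by case: eqP => //=; rewrite vq => cq; rewrite (@coinversion_conditionE q).
      over.
    case: (boolP (_ < _ <= _)%N) => rN; last by rewrite big1 // => c _; rewrite andbF.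
    (* A row in the interval satisfies both bounds, so its column of the prescribed content lies in
       the summation range and contributes exactly one triple. *)
    have leb := hf_beta hfN en rp (proj2 (andP rN)).
    have gtg : ~~ (f + q.+1%:Z <= position gamma r).
      apply/negP => /(hf_gamma hfN (ltnW en) rp); lia.
    move: leb gtg; rewrite /position => leb gtg.
    pose c := absz (f + q%:Z + r%:Z)%R.
    rewrite (bigD1_seq c) ?iota_uniq ?mem_index_iota //=; last by rewrite /c; lia.
    rewrite big1 ?addn0 => [|c' c'c]; first by rewrite andbT vq /content /c /=; lia.
    by rewrite andbT vq /content /=; move: c'c; rewrite /c; lia.
  over.
by rewrite -big_nat sum_half_open (minn_idPl (hf_le hfN q en)).
Qed.

End Weights.
(* The constraints in one colour on the vertical edges v and horizontal edges h. *)
Record path_labels (v h : nat -> nat -> bool) : Prop := PathLabels {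
  pl_bot : forall q, (q < nc)%N ->
    v 0%N q = has (fun m => f + q%:Z == position gamma m)%R (iota 1 (size gamma));
  pl_top : forall q, (q < nc)%N ->
    v n q = has (fun m => f + q%:Z == position beta m)%R (iota 1 (size beta));
  pl_left : forall e, (e < n)%N -> h e 0%N = false;
  pl_right : forall e, (e < n)%N -> h e nc = false;
  pl_flow : forall e q, (e < n)%N -> (q < nc)%N ->
    (v e q + h e q = v e.+1 q + h e q.+1)%N;
  pl_excl : forall e q, (e < n)%N -> (q < nc)%N -> ~~ (v e q && h e q) }.

(** * From edge labels of one colour to a height function *)

Definition lattice_height (v : nat -> nat -> bool) (e q : nat) : nat :=
  (\sum_(q <= i < nc) v e i)%N.

Lemma lattice_heightS (v : nat -> nat -> bool) e q : (q < nc)%N ->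
  lattice_height v e q = (v e q + lattice_height v e q.+1)%N.
Proof. by move=> qnc; rewrite /lattice_height big_ltn. Qed.

Lemma lattice_height_last (v : nat -> nat -> bool) e q : (nc <= q)%N -> lattice_height v e q = 0%N.
Proof. by move=> ncq; rewrite /lattice_height big_geq. Qed.

(** Induction leftwards from the right boundary, beyond which all heights vanish. *)
Lemma down_ind (P : nat -> Prop) :
  (forall q, (nc <= q)%N -> P q) -> (forall q, (q < nc)%N -> P q.+1 -> P q) ->
  forall q, P q.
Proof.
move=> Pge Pstep q; have [ge|lt] := leqP nc q; first exact: Pge.
rewrite -(subKn (ltnW lt)); elim: (nc - q)%N => [|d IH]; first by apply: Pge; lia.
have [le|gt] := leqP d.+1 nc; last by rewrite (_ : nc - d.+1 = nc - d)%N //; lia.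
by apply: Pstep; [lia | rewrite (_ : (nc - d.+1).+1 = nc - d)%N //; lia].
Qed.

Lemma lattice_height_boundary (v : nat -> nat -> bool) e (mu : seq nat) :
    (forall r, (1 <= r < p)%N -> (part mu r.+1 <= part mu r)%N) -> size mu = p ->
    (forall r, (1 <= r <= p)%N -> (part mu r <= part beta r)%N) ->
    (forall q, (q < nc)%N ->
      v e q = has (fun m => f + q%:Z == position mu m)%R (iota 1 (size mu))) ->
  forall q, lattice_height v e q = height mu q.
Proof.
move=> mu_anti size_mu mu_le vE; apply: down_ind => q qnc.
  rewrite lattice_height_last // /height big_nat big1 // => r rp.
  by have := lt_last (r := r); have := mu_le r; rewrite /position; lia.
by move=> IH; rewrite lattice_heightS // IH (height_step q mu_anti) // vE // addnC.
Qed.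

Section PathLabels.

Variables v h : nat -> nat -> bool.
Hypothesis plvh : path_labels v h.

(** Conservation summed over the columns from [q] rightwards telescopes, and nothing leaves through
    the right boundary. *)
Lemma lattice_height_right e q : (e < n)%N -> (q <= nc)%N ->
  lattice_height v e.+1 q = (lattice_height v e q + h e q)%N.
Proof.
move=> en; elim/down_ind: q => q qnc.
  move=> ?; rewrite !lattice_height_last // (_ : q = nc); last lia.
  by rewrite (pl_right plvh).
move=> IH _; rewrite !(lattice_heightS _ _ qnc) IH //; have := pl_flow plvh en qnc; lia.
Qed.

Lemma lattice_height_function : height_function (lattice_height v).
Proof.
split=> [e q _|e q en|e q en||].
- have [ge|lt] := leqP nc q; last by rewrite [leqRHS]lattice_heightS // leq_addl.
  by rewrite !lattice_height_last //; lia.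
- have [ge|lt] := leqP q nc; first by rewrite lattice_height_right // leq_addr.
  by rewrite !lattice_height_last //; lia.
- have [ge|lt] := leqP nc q; first by rewrite lattice_height_last.
  rewrite lattice_height_right //; last exact: ltnW.
  by rewrite lattice_heightS //; have := pl_excl plvh en lt; lia.
- by apply: lattice_height_boundary => //; apply: (pl_bot plvh).
by apply: lattice_height_boundary => //; apply: (pl_top plvh).
Qed.

End PathLabels.

(** * From a height function back to edge labels and to a filling *)

Section HeightLabels.

Variable N : nat -> nat -> nat.
Hypotheses (n_gt0 : (0 < n)%N) (hfN : height_function N).

Lemma hf_last e q : (e <= n)%N -> (nc <= q)%N -> N e q = 0%N.
Proof.
move=> en ncq; apply/eqP; rewrite -leqn0 -(height_beta_last ncq) -(hf_top hfN).
by apply: (hf_row_le hfN); rewrite en leqnn.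
Qed.

Lemma hf_first e : (e <= n)%N -> N e 0%N = p.
Proof.
move=> en; apply/eqP; rewrite eqn_leq (hf_le hfN) //= -{1}height_gamma0 -(hf_bot hfN).
exact: (hf_row_le hfN).
Qed.

Lemma path_labels_height :
  path_labels (fun e q => N e q.+1 < N e q)%N (fun e q => N e q < N e.+1 q)%N.
Proof.
split=> [q qnc|q qnc|e en|e en|e q en qnc|e q en qnc].
- by rewrite !(hf_bot hfN) (height_step q gamma_anti) //; case: has; lia.
- by rewrite !(hf_top hfN) (height_step q beta_anti) //; case: has; lia.
- by rewrite !hf_first ?ltnn // ltnW.
- by rewrite !hf_last ?ltnn // ltnW.
all: have := hf_step hfN q en; have := hf_row hfN q en; have := hf_row hfN q.+1 en.
all: have := hf_col hfN q (ltnW en); have := hf_col hfN q en; lia.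
Qed.

Lemma lattice_heightK e q : (e <= n)%N ->
  lattice_height (fun e q => N e q.+1 < N e q)%N e q = N e q.
Proof.
move=> en; elim/down_ind: q => q qnc; first by rewrite lattice_height_last // hf_last.
move=> IH; rewrite lattice_heightS // IH.
by have := hf_col hfN q en; have := hf_col_step hfN q n_gt0 en; lia.
Qed.

(** The entry, numbered from 0, is the number of levels from 1 to [n] at which the cell is not yet
    included. For a height function the default of [insubd] never occurs, since the cell is included
    at level [n]. *)
Definition height_filling : filling n beta gamma :=
  [ffun u => insubd (Ordinal n_gt0) (\sum_(1 <= e < n.+1) (N e (diagonal u).+1 < row u))%N].

Lemma height_filling_encodes : encodes height_filling N.
Proof.
move=> u e en; rewrite ffunE val_insubd; set cnt := (X in (X < n)%N).
pose P e := (N e (diagonal u).+1 < row u)%N.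
have [rp cu] := cellP u; have du := diagonalE u.
have P0 : P 0%N.
  by rewrite /P (hf_bot hfN) ltnNge (leq_height gamma_anti) // /position; lia.
have Pn : ~~ P n.
  by rewrite /P (hf_top hfN) -leqNgt (leq_height beta_anti) // /position; lia.
have prefix : forall e, (1 <= e <= n)%N -> (e <= cnt)%N = P e.
  apply: leq_sum_prefix => e' e'n; apply: leq_ltn_trans; apply: (hf_row hfN); lia.
rewrite [(cnt < n)%N]ltnNge prefix ?n_gt0 ?leqnn // (negbTE Pn) /=.
case: e en => [|e] en; first by rewrite ltn0 leqNgt [(_ < _)%N]P0.
by rewrite ltnNge prefix ?en // /P -leqNgt.
Qed.

End HeightLabels.

End Heights.

(** * All colours: labelings against tuples of tableaux *)

Section Lattice.

Variables (k n : nat) (p : 'I_k -> nat) (beta gamma : 'I_k -> seq nat).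
Local Notation f := (first_column gamma).
Local Notation nc := (n_columns beta gamma).
Hypotheses (n_gt0 : (0 < n)%N)
           (window : forall j, skew_window (p j) nc f (beta j) (gamma j)).

Implicit Types (T : tuple_filling n beta gamma)
  (V : 'M[label k]_(n.+1, nc)) (H : 'M[label k]_(n, nc.+1)).

Definition admissible_face (I J K L : label k) : bool :=
  [forall i, (I i + J i)%N == (K i + L i)%N] && ~~ [exists i, I i && J i].

Definition admissible V H : bool :=
  [forall e : 'I_n, forall q : 'I_nc, admissible_face
     (V (widen_ord (leqnSn n) e) q) (H e (widen_ord (leqnSn _) q))
     (V (lift ord0 e) q) (H e (lift ord0 q))].

(** All these conditions are componentwise in the colours; only the power of [t] couples them.
    Leaving the extensions [v] and [h] to natural indices free lets this apply both to [entry] and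
    to heights of tableaux. *)
Lemma admissibleP V H (v h : 'I_k -> nat -> nat -> bool) :
    (forall e q j, V e q j = v j e q) -> (forall e q j, H e q j = h j e q) ->
  reflect (forall j, path_labels n nc f (beta j) (gamma j) (v j) (h j))
          (boundary_labels V H && admissible V H).
Proof.
move=> VE HE; apply: (iffP andP) => [[/andP[/forallP bdV /forallP bdH] /forallP adm] j|pl].
  have face (e : 'I_n) (q : 'I_nc) : (v j e q + h j e q = v j e.+1 q + h j e q.+1)%N /\
      ~~ (v j e q && h j e q).
    have /forallP/(_ q)/andP[/forallP/(_ j)/eqP flow /existsPn/(_ j) excl] := adm e.
    by move: flow excl; rewrite !VE !HE.
  split=> [q qnc|q qnc|e en|e en|e q en qnc|e q en qnc].
  - have /andP[/eqP/ffunP/(_ j)] := bdV (Ordinal qnc).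
    by rewrite VE ffunE.
  - have /andP[_ /eqP/ffunP/(_ j)] := bdV (Ordinal qnc).
    by rewrite VE ffunE.
  - have /andP[/eqP/ffunP/(_ j)] := bdH (Ordinal en).
    by rewrite HE ffunE.
  - have /andP[_ /eqP/ffunP/(_ j)] := bdH (Ordinal en).
    by rewrite HE ffunE.
  - by have [] := face (Ordinal en) (Ordinal qnc).
  - by have [] := face (Ordinal en) (Ordinal qnc).
split; first (apply/andP; split).
- apply/forallP => q; apply/andP; split; apply/eqP/ffunP => j; rewrite VE ffunE.
    exact: (pl_bot (pl j)).
  exact: (pl_top (pl j)).
- apply/forallP => e; apply/andP; split; apply/eqP/ffunP => j; rewrite HE ffunE.
    exact: (pl_left (pl j)).
  exact: (pl_right (pl j)).
apply/forallP => e; apply/forallP => q; apply/andP; split.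
  by apply/forallP => j; rewrite !VE !HE; apply/eqP; exact: (pl_flow (pl j) (ltn_ord e) (ltn_ord q)).
by apply/existsPn => j; rewrite VE HE; exact: (pl_excl (pl j) (ltn_ord e) (ltn_ord q)).
Qed.

Definition entry (m1 m2 : nat) (M : 'M[label k]_(m1, m2)) (j : 'I_k) (e q : nat) : bool :=
  if insub e is Some e' then if insub q is Some q' then M e' q' j else false else false.

Lemma entryE (m1 m2 : nat) (M : 'M[label k]_(m1, m2)) e q j : M e q j = entry M j e q.
Proof. by rewrite /entry !valK. Qed.

Local Notation theight T j := (tableau_height (p j) f (T j)).

Definition tableau_labels T : 'M[label k]_(n.+1, nc) * 'M[label k]_(n, nc.+1) :=
  (\matrix_(e, q) [ffun j => theight T j e q.+1 < theight T j e q]%N,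
   \matrix_(e, q) [ffun j => theight T j e q < theight T j e.+1 q]%N).

Definition labels_tableau
    (VH : 'M[label k]_(n.+1, nc) * 'M[label k]_(n, nc.+1)) : tuple_filling n beta gamma :=
  [ffun j => height_filling f (beta j) (gamma j) (lattice_height nc (entry VH.1 j)) n_gt0].

Lemma tableau_labelsP T : [forall j, semistandard (T j)] ->
  boundary_labels (tableau_labels T).1 (tableau_labels T).2 &&
  admissible (tableau_labels T).1 (tableau_labels T).2.
Proof.
move=> /forallP ssT; apply/(@admissibleP _ _
  (fun j e q => theight T j e q.+1 < theight T j e q)%N
  (fun j e q => theight T j e q < theight T j e.+1 q)%N).
- by move=> e q j; rewrite mxE ffunE.
- by move=> e q j; rewrite mxE ffunE.
move=> j; apply: (path_labels_height (window j)) => //.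
exact: (tableau_height_function (window j)).
Qed.

Lemma labels_tableauP V H : boundary_labels V H && admissible V H ->
  forall j, height_function (p j) n f (beta j) (gamma j) (lattice_height nc (entry V j)) /\
    encodes f (labels_tableau (V, H) j) (lattice_height nc (entry V j)).
Proof.
move=> /(admissibleP (entryE V) (entryE H)) pl j.
have hf := lattice_height_function (window j) (pl j).
by split=> //; rewrite ffunE; apply: (height_filling_encodes (window j)).
Qed.

Lemma labels_tableau_semistandard V H : boundary_labels V H && admissible V H ->
  [forall j, semistandard (labels_tableau (V, H) j)].
Proof.
move=> /labels_tableauP VH; apply/forallP => j; have [hf enc] := VH j.
exact: (encodes_semistandard (window j) hf enc).
Qed.

(** Both tableaux are encoded by the same height function, so [encodes_inj] identifies them. *)
Lemma tableau_labelsK T : [forall j, semistandard (T j)] ->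
  labels_tableau (tableau_labels T) = T.
Proof.
move=> ssT; have /labels_tableauP lt := tableau_labelsP ssT.
apply/ffunP => j; have [_ enc] := lt j; have /forallP/(_ j) ssTj := ssT.
have hf := tableau_height_function (window j) ssTj.
apply: (encodes_inj (N := theight T j)) (tableau_height_encodes (window j) ssTj).
move=> u e en; rewrite [tableau_labels T]surjective_pairing enc //; congr (_ <= _)%N.
rewrite -(lattice_heightK (window j) n_gt0 hf) //; apply: eq_big_nat => i /andP[_ inc].
have en1 : (e < n.+1)%N by [].
by rewrite -(entryE _ (Ordinal en1) (Ordinal inc)) mxE ffunE.
Qed.

(** The heights of the labeling and those of its tableau encode the same tableau, hence agree by
    [encodes_uniq]; the labels are differences of heights. *)
Lemma labels_tableauK V H : boundary_labels V H && admissible V H ->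
  tableau_labels (labels_tableau (V, H)) = (V, H).
Proof.
move=> VH; have /(admissibleP (entryE V) (entryE H)) pl := VH.
have /forallP ss := labels_tableau_semistandard VH.
set T := labels_tableau (V, H) in ss *.
have eqN j e q : (e <= n)%N -> theight T j e q = lattice_height nc (entry V j) e q.
  have [hf enc] := labels_tableauP VH j; apply: (encodes_uniq (window j) _ hf _ enc).
    exact: (tableau_height_function (window j)).
  exact: (tableau_height_encodes (window j)).
congr pair; apply/matrixP => e q; apply/ffunP => j; rewrite mxE ffunE.
  have en : (e <= n)%N by rewrite -ltnS.
  rewrite !eqN // (lattice_heightS _ _ (ltn_ord q)) -entryE; case: (V e q j); lia.
rewrite !eqN //; last exact: ltnW.
rewrite (lattice_height_right (window j) (pl j)) // -1?ltnS // -entryE; case: (H e q j); lia.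
Qed.

Section Weight.

Variables (T : tuple_filling n beta gamma) (ssT : [forall j, semistandard (T j)]).

Let hf j : height_function (p j) n f (beta j) (gamma j) (theight T j).
Proof. by apply: (tableau_height_function (window j)); apply: (forallP ssT). Qed.

Let enc j : encodes f (T j) (theight T j).
Proof. by apply: (tableau_height_encodes (window j)); apply: (forallP ssT). Qed.

Lemma sum_size_labels (e : 'I_n) :
  (\sum_(q < nc) lsize ((tableau_labels T).2 e (lift ord0 q))
   = \sum_(a < k) \sum_(u | T a u == e) 1)%N.
Proof.
rewrite exchange_big /=; apply: eq_bigr => a _.
rewrite -(sum_right_labels (window a) (hf a) (@enc a) e (fun=> 1%N)).
by apply: eq_bigr => q _; rewrite mxE ffunE muln1.
Qed.

Lemma coinv_labels :
  (\sum_(e < n) \sum_(q < nc) \sum_(m < k | (tableau_labels T).2 e (lift ord0 q) m)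
     (lsum_above ((tableau_labels T).1 (widen_ord (leqnSn n) e) q) m +
      lsum_above ((tableau_labels T).2 e (widen_ord (leqnSn _) q)) m) = coinv T)%N.
Proof.
(* By [hf_face] this counts the paths of colours above [a] entering the face [(e, q)]; by
   [sum_coinversion_triples] it also counts the triples whose [v] is a given cell of colour [a] with
   entry [e] on diagonal [q]. *)
pose G (a : 'I_k) (e q : nat) :=
  (\sum_(b < k | (a < b)%N) (theight T b e.+1 q - theight T b e q.+1))%N.
transitivity (\sum_(a < k) \sum_u G a (T a u) (diagonal f u))%N.
  transitivity (\sum_(a < k) \sum_(e < n) \sum_(u | T a u == e) G a e (diagonal f u))%N.
    rewrite [RHS]exchange_big /=; apply: eq_bigr => e _.
    under [RHS]eq_bigr => a _.
      rewrite -(sum_right_labels (window a) (hf a) (@enc a) e (G a e)); over.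
    rewrite [RHS]exchange_big /=; apply: eq_bigr => q _.
    rewrite big_mkcond; apply: eq_bigr => a _; rewrite mxE ffunE /= /lsum_above -big_split /=.
    case: ifP => _; rewrite ?mul0n ?mul1n //; apply: eq_bigr => b _.
    rewrite !mxE !ffunE /=.
    exact: (hf_face (window b) (hf b) _ (ltn_ord e)).
  apply: eq_bigr => a _; rewrite (exchange_big_dep predT) //=; apply: eq_bigr => u _.
  by rewrite (big_pred1 (T a u)) // => e; rewrite /= eq_sym.
rewrite /coinv /G; apply: eq_bigr => a _; rewrite exchange_big /=.
apply: eq_bigr => b ab; apply: eq_bigr => u _.
rewrite (sum_coinversion_triples (window b) (hf b) (@enc b) (T a u) (q := diagonal f u)) //.
by rewrite (diagonalE (window a)).
Qed.

Lemma tableau_labels_weight (R : comNzRingType) (x : 'I_n -> R) (t : R) :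
  \prod_(e < n) \prod_(q < nc)
    face_weight t (x e)
      ((tableau_labels T).1 (widen_ord (leqnSn n) e) q)
      ((tableau_labels T).2 e (widen_ord (leqnSn _) q))
      ((tableau_labels T).1 (lift ord0 e) q) ((tableau_labels T).2 e (lift ord0 q))
  = t ^+ coinv T * \prod_(a < k) \prod_u x (T a u).
Proof.
have /andP[_ /forallP adm] := tableau_labelsP ssT.
under eq_bigr => e _.
  under eq_bigr => q _.
    have /forallP/(_ q) fadm := adm e.
    rewrite /face_weight -/(admissible_face _ _ _ _) fadm prodrXr; over.
  rewrite big_split /= !prodrXr sum_size_labels; over.
rewrite big_split /= prodrXr coinv_labels mulrC; congr (_ * _).
under eq_bigr => e _ do rewrite -prodrXr.
rewrite exchange_big /=; apply: eq_bigr => a _.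
under eq_bigr => e _ do rewrite -prodrXr.
rewrite (exchange_big_dep predT) //=; apply: eq_bigr => u _.
by rewrite (big_pred1 (T a u)) // => e; rewrite /= eq_sym.
Qed.

End Weight.

(** Labelings with an inadmissible face contribute zero; the others are reindexed by semistandard
    tuples, with equal weights. *)
Theorem lattice_Z_coinv_LLT (R : comNzRingType) (x : 'I_n -> R) (t : R) :
  lattice_Z beta gamma x t = coinv_LLT beta gamma x t.
Proof.
rewrite /lattice_Z /coinv_LLT pair_big_dep /=.
rewrite (bigID (fun VH => admissible VH.1 VH.2)) /= [X in _ + X]big1 ?addr0 => [|[V H]]; last first.
  case/andP=> _ /forallPn[e /forallPn[q nadm]].
  rewrite (bigD1 e) //= (bigD1 q) //= /face_weight -/(admissible_face _ _ _ _) (negbTE nadm).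
  by rewrite !mul0r.
rewrite (reindex_onto tableau_labels labels_tableau) => [|[V H] /labels_tableauK //].
apply: eq_big => [T|T]; last first.
  case/andP=> VH /eqP TE; apply: tableau_labels_weight; rewrite -TE.
  by rewrite [tableau_labels T]surjective_pairing; apply: labels_tableau_semistandard.
apply/idP/idP => [/andP[VH /eqP TE]|ssT].
  rewrite -TE [tableau_labels T]surjective_pairing.
  exact: labels_tableau_semistandard.
by rewrite tableau_labelsP //= tableau_labelsK.
Qed.

End Lattice.

(** * The lattice is wide enough for the given partitions *)

Lemma is_partition_anti (p : nat) (mu : seq nat) : is_partition p mu ->
  forall r, (1 <= r < p)%N -> (part mu r.+1 <= part mu r)%N.
Proof.
case=> size_mu sorted_mu [//|r] rp; rewrite /part /=.
by move/(sortedP 0%N): sorted_mu; apply; rewrite size_mu.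
Qed.

Lemma mem_positions (k : nat) (mu : 'I_k -> seq nat) (j : 'I_k) (r : nat) :
  (1 <= r <= size (mu j))%N -> label_at mu (position (mu j) r) != label0 k.
Proof.
move=> rp; rewrite label_at_neq0; apply/allpairsPdep; exists j, r.
by rewrite mem_enum mem_iota; split=> //; lia.
Qed.

Theorem theorem3p4 (k n : nat) (p : 'I_k -> nat)
    (beta gamma : 'I_k -> seq nat)
    (k_gt0 : (1 <= k)%N) (n_gt0 : (1 <= n)%N)
    (p_gt0 : forall j : 'I_k, (1 <= p j)%N)
    (beta_part : forall j : 'I_k, is_partition (p j) (beta j))
    (gamma_part : forall j : 'I_k, is_partition (p j) (gamma j))
    (gamma_le_beta : forall (j : 'I_k) (m : nat),
       (1 <= m <= p j)%N -> (part (gamma j) m <= part (beta j) m)%N) :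
  lattice_Z_poly n beta gamma = coinv_LLT_poly n beta gamma.
Proof.
apply: (lattice_Z_coinv_LLT (p := p)) => // j.
have [[size_b _] [size_g _]] := (beta_part j, gamma_part j).
have first_le r : (1 <= r <= p j)%N -> first_column gamma <= position (gamma j) r.
  by rewrite -size_g => /mem_positions/first_columnP[].
have le_last r : (1 <= r <= p j)%N -> position (beta j) r <= last_column beta.
  by rewrite -size_b => /mem_positions/last_columnP[].
split=> // [|||r rp].
- exact: (is_partition_anti (beta_part j)).
- exact: (is_partition_anti (gamma_part j)).
- exact: gamma_le_beta.
(* The first column, the position in [gamma], the position in [beta] and the last column are in
   increasing order, so [absz] in [n_columns] acts on a nonnegative number. *)
have := first_le r rp; have := le_last r rp; have := gamma_le_beta j r rp.
by rewrite /n_columns /position; lia.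
Qed.
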